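(* $$\sum_{k=0}^{\infty}\frac{\binom{3k}{k}\binom{6k}{3k}}{864^k}\,(6H_{6k}-3H_{3k}-2H_{2k}+H_k)=\frac{(\log 2)\sqrt{\pi}}{\Gamma(\frac{7}{12})\,\Gamma(\frac{11}{12})}.$$
   Context: For a nonnegative integer $n$, $H_n=\sum_{j=1}^{n}\frac{1}{j}$ denotes the classical harmonic number, with $H_0=0$. $\Gamma$ is the gamma function and $\log$ is the natural logarithm. *)

(* Defs.v *)
From mathcomp Require Import all_boot all_order all_algebra.
From mathcomp Require Import all_classical all_reals all_analysis.

Set Implicit Arguments.
Unset Strict Implicit.
Unset Printing Implicit Defensive.

Import Order.TTheory GRing.Theory Num.Theory.
Import numFieldNormedType.Exports.

Local Open Scope classical_set_scope.
Local Open Scope ring_scope.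

Definition harmonic_number (R : realType) (n : nat) : R :=
  \sum_(1 <= j < n.+1) j%:R^-1.

(* Euler's integral: this is the Gamma function for 0 < x only; for x <= 0 the
   integral diverges and the value below is meaningless. *)
Definition Gamma (R : realType) (x : R) : R :=
  \int[@lebesgue_measure R]_(t in `]0, +oo[) (t `^ (x - 1) * expR (- t)).

(* Main.v *)
Require Import Defs.
From mathcomp Require Import all_boot all_order all_algebra.
From mathcomp Require Import all_classical all_reals all_analysis.
From mathcomp Require Import measurable_realfun ring lra zify.

Set Implicit Arguments.
Unset Strict Implicit.
Unset Printing Implicit Defensive.

Import Order.TTheory GRing.Theory Num.Theory.
Import numFieldNormedType.Exports.

Local Open Scope classical_set_scope.
Local Open Scope ring_scope.

(** Write (x)_k for the rising factorial and, for 0 < a < 1, put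
    c_k = (a)_k (1 - a)_k / k!^2, the coefficients of the hypergeometric
    function F(a, 1 - a; 1; x).  For a = 1/6 the binomial product of the theorem
    is 432^k c_k, so the weights are c_k / 2^k, and the combination of harmonic
    numbers collapses to
      S_k = sum_(j < k) (1 / (a + j) + 1 / (1 - a + j)),
    the logarithmic derivative of (a + e)_k (1 - a + e)_k at e = 0.

    Euler's transformation
      F(a + e, 1 - a + e; 1; x) = (1 - x)^(-2e) F(a - e, 1 - a - e; 1; x)
    has, up to the exchange of the first two parameters, the same function at
    -e on its right.  Differentiating at e = 0 gives
      sum_k c_k S_k x^k = - ln (1 - x) * sum_k c_k x^k.
    This identity is proved coefficientwise: c_n S_n is the convolution of c with
    1, 1/2, 1/3, and so on ([legendre_coef_dlog]), because both sides satisfy the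
    same first-order recurrence.  At x = 1/2 the Cauchy product
    ([series_cauchy_prod]) splits off the factor ln 2 ([series_ln2]).

    There remains the value of F(a, 1 - a; 1; 1/2), a case of Bailey's theorem.
    Let the lower parameter 1 vary: phi(c) = F(a, 1 - a; c; 1/2).  A telescoping
    certificate ([bailey_telescope]) yields
      c (c + 1) phi(c) = (c + a) (c + 1 - a) phi(c + 2),
    and phi(c) tends to 1 as c grows, so phi(1) is the limit of a ratio of rising
    factorials with base points (1 + a)/2 and 1 - a/2 over 1/2 and 1.  Gauss's
    product for Gamma ([Gamma_Gauss_product]) evaluates that limit
    ([bailey_sum_Gamma]); it needs of Gamma only the functional equation, Wendel's
    inequality, and Gamma(1/2) = sqrt pi, which is the Gaussian integral. *)

(** * Rising factorials *)

Definition rising (R : realType) (x : R) (n : nat) : R :=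
  \prod_(j < n) (x + j%:R).

Lemma risingS (R : realType) (x : R) n : rising x n.+1 = rising x n * (x + n%:R).
Proof. by rewrite /rising big_ord_recr. Qed.

Lemma rising_gt0 (R : realType) (x : R) n : 0 < x -> 0 < rising x n.
Proof. by move=> x0; apply: prodr_gt0 => i _; rewrite ltr_wpDr. Qed.

Lemma rising1 (R : realType) n : rising (1 : R) n = n`!%:R.
Proof.
elim: n => [|n IHn]; first by rewrite /rising big_ord0.
by rewrite risingS IHn factS mulnC natrM -(natr1 n) addrC.
Qed.

(** Both sides are (c)_(k + 2); this relates the terms of phi(c) and phi(c + 2). *)
Lemma rising_addr2 (R : realType) (c : R) k :
  c * (c + 1) * rising (c + 2) k = rising c k * (c + k%:R) * (c + k%:R + 1).
Proof.
elim: k => [|k IHk]; first by rewrite /rising !big_ord0 addr0 mul1r mulr1.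
by rewrite !risingS mulrA IHk -natr1; ring.
Qed.

(** * The Gamma function *)

Section Gamma.
Context {R : realType}.
Notation mu := (@lebesgue_measure R).

Definition gamma_integrand (x t : R) : R := t `^ (x - 1) * expR (- t).
(** Gamma before truncation to a real number.  Limits, sums and comparisons of
    nonnegative integrals hold for it unconditionally, so that the functional
    equation can be proved first and then used to show that it is finite. *)
Definition eGamma (x : R) : \bar R :=
  (\int[mu]_(t in `]0%R, +oo[) (gamma_integrand x t)%:E)%E.

Lemma gamma_integrand_ge0 x t : 0 <= gamma_integrand x t.
Proof. by rewrite mulr_ge0 ?powR_ge0 ?expR_ge0. Qed.

Lemma measurable_gamma_integrand x D : measurable_fun D (gamma_integrand x).
Proof.
apply: measurable_funTS; apply: measurable_funM => //.
by apply: measurableT_comp => //; exact: measurable_expR.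
Qed.

Lemma gamma_integrandD1 x t : 0 < t -> gamma_integrand (x + 1) t = t * gamma_integrand x t.
Proof.
move=> t0; rewrite /gamma_integrand mulrA; congr (_ * _).
rewrite addrK -[X in X * _](powRr1 (ltW t0)) -powRD; first by rewrite addrC subrK.
by rewrite (gt_eqF t0) implybT.
Qed.

(** Calculus on a compact [[1/b, b]] avoids both singular ends of ]0, +oo[:
    powers are not differentiable at 0, and for x < 1 the integrand of Gamma is
    unbounded there. *)
Lemma cvg_integral_exhaust (f : R -> R) (b : R^nat) :
  measurable_fun setT f -> (forall t, 0 <= f t) ->
  nondecreasing_seq b -> (forall n, 0 < b n) -> b @ \oo --> +oo ->
  (\int[mu]_(t in `[(b n)^-1%R, b n]) (f t)%:E @[n --> \oo] -->
   \int[mu]_(t in `]0%R, +oo[) (f t)%:E)%E.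
Proof.
move=> mf f0 nb b0 boo.
have -> : `]0, +oo[%classic = \bigcup_n `[(b n)^-1, b n]%classic.
  apply/seteqP; split => [t|t [n _]]/=; rewrite !in_itv/=; last first.
    by move=> /andP[h _]; rewrite andbT (lt_le_trans _ h)// invr_gt0.
  rewrite andbT => t0.
  have [N _ bN] : \forall n \near \oo, Num.max t t^-1 <= b n.
    by have /cvgryPge := boo; exact.
  exists N => //=; rewrite in_itv/=.
  have := bN N (leqnn _); rewrite /= ge_max => /andP[-> tb].
  by rewrite andbT -[t]invrK lef_pV2 ?posrE// invr_gt0.
apply: ge0_nondecreasing_set_cvg_integral => //.
- move=> m n mn; apply/subsetPset => t /=; rewrite !in_itv/= => /andP[h1 h2].
  rewrite (le_trans h2 (nb _ _ mn)) andbT (le_trans _ h1)//.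
  by rewrite lef_pV2 ?posrE// nb.
- by move=> n; apply/measurable_EFinP; exact: measurable_funTS.
- by move=> n t _; rewrite lee_fin.
Qed.

Lemma continuous_powR (x t : R) : 0 < t -> {for t, continuous (@powR R ^~ x)}.
Proof.
move=> t0; apply: differentiable_continuous; apply/derivable1_diffP.
by apply: derivable_powR; rewrite in_itv/= t0.
Qed.

Lemma derivable_oo_LR (F : R -> R) u v : u < v ->
  (forall t, u <= t <= v -> derivable F t 1) -> derivable_oo_LRcontinuous F u v.
Proof.
move=> uv dF.
have cF t : u <= t <= v -> {for t, continuous F}.
  by move=> /dF; rewrite derivable1_diffP => /differentiable_continuous.
split.
- by move=> t; rewrite in_itv/= => /andP[ut tv]; apply: dF; rewrite !ltW.
- by apply: cvg_at_right_filter; apply: cF; rewrite lexx ltW.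
- by apply: cvg_at_left_filter; apply: cF; rewrite lexx ltW.
Qed.

Lemma gamma_by_parts (x u v : R) : 0 < x -> 0 < u -> u < v ->
  (\int[mu]_(t in `[u, v]) (gamma_integrand (x + 1) t)%:E =
   (gamma_integrand (x + 1) u - gamma_integrand (x + 1) v)%:E +
   x%:E * \int[mu]_(t in `[u, v]) (gamma_integrand x t)%:E)%E.
Proof.
move=> x0 u0 uv.
have pos t : t \in `[u, v] -> 0 < t by rewrite in_itv/= => /andP[/(lt_le_trans u0)].
have dexp (t : R) : is_derive t 1 (fun t : R => - expR (- t)) (expR (- t)).
  by apply: is_derive_eq; rewrite mulrN1 opprK.
have ibp := @integration_by_parts R (@powR R ^~ x) (fun t => - expR (- t))
  (fun t => x * t `^ (x - 1)) (fun t => expR (- t)) u v uv.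
rewrite {1}/gamma_integrand addrK ibp.
- congr (_ + _)%E; first by rewrite /gamma_integrand addrK; congr EFin; ring.
  rewrite -ge0_integralZl_EFin ?ltW//; last 2 first.
  - by move=> t _; rewrite lee_fin gamma_integrand_ge0.
  - by apply/measurable_EFinP; exact: measurable_gamma_integrand.
  rewrite -[RHS]oppeK; congr (- _)%E; rewrite -integral_ge0N; last first.
    move=> t _; rewrite -EFinM lee_fin mulr_ge0 ?gamma_integrand_ge0//; exact: ltW.
  by apply: eq_integral => t _; rewrite -EFinM -EFinN /gamma_integrand; congr EFin; ring.
- apply: continuous_in_subspaceT => t; rewrite inE/= => /pos t0.
  by apply: cvgM; [exact: cvg_cst|exact: continuous_powR].
- apply: derivable_oo_LR => // t /andP[ut _].
  by apply: derivable_powR; rewrite in_itv/= (lt_le_trans u0 ut).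
- move=> t; rewrite in_itv/= => /andP[ut _].
  by rewrite powR_derive1// in_itv/= (lt_trans u0 ut).
- apply: continuous_in_subspaceT => t _.
  by apply: continuous_comp; [exact: continuousN|exact: continuous_expR].
- by apply: derivable_oo_LR => // t _; have [] := dexp t.
- by move=> t _; rewrite derive1E; have [_ ->] := dexp t.
Qed.

Lemma gamma_integrand_at0 (x : R) (b : R^nat) : 0 < x -> (forall n, 0 < b n) -> b @ \oo --> 0 ->
  gamma_integrand (x + 1) (b n) @[n --> \oo] --> 0.
Proof.
move=> x0 b0 bcv.
have /cvg_at_rightP h := powR_cvg0 x0.
apply: (@squeeze_cvgr _ _ _ _ (fun=> 0) (fun n => b n `^ x)); [|exact: cvg_cst|exact: h].
apply: nearW => n; rewrite gamma_integrand_ge0/= /gamma_integrand addrK ler_piMr ?powR_ge0//.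
by rewrite -expR0 ler_expR oppr_le0 ltW.
Qed.

(** Raise t / (x + 1) <= exp (t / (x + 1)) to the power x + 1: the resulting
    bound on t^(x+1) exp (- t) shows that the integrand decays like 1/t. *)
Lemma gamma_integrand_le (x t : R) : 0 < x -> 0 < t ->
  gamma_integrand (x + 1) t <= (x + 1) `^ (x + 1) / t.
Proof.
move=> x0 t0; rewrite /gamma_integrand addrK.
have x1 : 0 < x + 1 by rewrite addr_gt0.
have /(ge0_ler_powR (ltW x1)) : t / (x + 1) <= expR (t / (x + 1)).
  by apply: le_trans (expR_ge1Dx _); rewrite lerDr.
have tx0 : 0 <= t / (x + 1) by rewrite divr_ge0// ltW.
rewrite !nnegrE tx0 expR_ge0 => /(_ isT isT).
have xV0 : 0 <= (x + 1)^-1 by rewrite invr_ge0 ltW.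
rewrite -expRM divfK ?gt_eqF// powRM//; last exact: ltW.
rewrite expRN ler_pdivrMr ?expR_gt0// => h.
have p0 : 0 < (x + 1) `^ (x + 1) by rewrite powR_gt0.
apply: (@le_trans _ _ ((x + 1) `^ (x + 1) / t * 
  (t `^ (x + 1) * (x + 1)^-1 `^ (x + 1)))); last first.
  by rewrite ler_wpM2l// divr_ge0// ltW.
rewrite -(powR_inv1 (ltW x1)) -powRrM mulN1r powRN.
rewrite [t `^ (x + 1)]powRD; last by rewrite (gt_eqF t0) implybT.
rewrite (powRr1 (ltW t0)).
by rewrite le_eqVlt; apply/orP; left; apply/eqP; field; rewrite !gt_eqF.
Qed.

Lemma gamma_integrand_aty (x : R) (b : R^nat) : 0 < x -> (forall n, 0 < b n) ->
  (b n)^-1 @[n --> \oo] --> 0 -> gamma_integrand (x + 1) (b n) @[n --> \oo] --> 0.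
Proof.
move=> x0 b0 bcv.
apply: (@squeeze_cvgr _ _ _ _ (fun=> 0) (fun n => (x + 1) `^ (x + 1) / b n)).
- by apply: nearW => n; rewrite gamma_integrand_ge0 gamma_integrand_le.
- exact: cvg_cst.
- by have := cvgM (cvg_cst ((x + 1) `^ (x + 1))) bcv; rewrite mulr0; exact.
Qed.

(** The boundary terms of [gamma_by_parts] vanish as the interval exhausts ]0, +oo[. *)
Lemma eGammaD1 x : 0 < x -> eGamma (x + 1) = (x%:E * eGamma x)%E.
Proof.
move=> x0.
pose b n := n.+2%:R : R.
have b0 n : 0 < b n by rewrite ltr0n.
have nb : nondecreasing_seq b by move=> m n mn; rewrite ler_nat !ltnS.
have boo : b @ \oo --> +oo.
  apply/cvgryPge => A; near=> n; apply: (@le_trans _ _ n%:R); last by rewrite ler_nat ltnW// ltnW.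
  by near: n; exact: nbhs_infty_ger.
have bV : (b n)^-1 @[n --> \oo] --> 0.
  by apply/gtr0_cvgV0 => //; exact: nearW.
have ex y := @cvg_integral_exhaust (gamma_integrand y) b (@measurable_gamma_integrand y setT)
  (gamma_integrand_ge0 y) nb b0 boo.
apply: (cvg_unique _ (ex (x + 1))) => //.
have bV0 n : 0 < (b n)^-1 by rewrite invr_gt0.
have -> : (fun n => \int[mu]_(t in `[(b n)^-1%R, b n]) (gamma_integrand (x + 1) t)%:E)%E =
  (fun n => (gamma_integrand (x + 1) (b n)^-1 - gamma_integrand (x + 1) (b n))%:E +
   x%:E * \int[mu]_(t in `[(b n)^-1%R, b n]) (gamma_integrand x t)%:E)%E.
  apply/funext => n; apply: gamma_by_parts => //.
  by rewrite (@lt_trans _ _ 1)// ?invf_lt1// ltr1n.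
have bdry : (gamma_integrand (x + 1) (b n)^-1 -
    gamma_integrand (x + 1) (b n))%:E @[n --> \oo] --> 0%E.
  apply: cvg_EFin; first exact: nearW.
  have := cvgB (gamma_integrand_at0 x0 bV0 bV) (gamma_integrand_aty x0 b0 bV).
  by rewrite subr0; exact.
have := cvgeD _ bdry (cvgeZl (y := x%:E) isT (ex x)).
by rewrite add0e; apply.
Unshelve. end_near. Qed.

Lemma eGamma_ge0 x : (0 <= eGamma x)%E.
Proof. by apply: integral_ge0 => t _; rewrite lee_fin gamma_integrand_ge0. Qed.

Lemma eGamma1 : eGamma 1 = 1%E.
Proof.
rewrite /eGamma integral_itv_obnd_cbnd; last first.
  by apply/measurable_EFinP; exact: measurable_gamma_integrand.
have gE : gamma_integrand 1 = fun t => expR (- t).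
  by apply/funext => t; rewrite /gamma_integrand subrr powRr0 mul1r.
have dexp (t : R) : is_derive t 1 (fun t : R => - expR (- t)) (expR (- t)).
  by apply: is_derive_eq; rewrite mulrN1 opprK.
have cexp : continuous (fun t : R => expR (- t)).
  by move=> t; apply: continuous_comp; [exact: continuousN|exact: continuous_expR].
rewrite gE (@ge0_continuous_FTC2y _ _ (fun t => - expR (- t)) 0 0).
- by rewrite oppr0 expR0 -EFinB sub0r opprK.
- by move=> t _; exact: expR_ge0.
- exact: continuous_subspaceT.
- by rewrite -[X in _ --> X]oppr0; apply: cvgN; exact: cvgr_expR.
- by move=> t _; have [] := dexp t.
- by apply: cvg_at_right_filter; apply: cvgN; exact: cexp.
- by move=> t _; rewrite derive1E; have [_ ->] := dexp t.
Qed.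

(** The concave function s^th lies below its tangent at s = 1; this is Young's inequality. *)
Lemma powR_le_chord (s th : R) : 0 <= s -> 0 <= th <= 1 -> s `^ th <= th * s + (1 - th).
Proof.
move=> s0 /andP[]; rewrite le_eqVlt => /predU1P[<- _|th0].
  by rewrite powRr0 mul0r add0r subr0.
rewrite le_eqVlt => /predU1P[->|th1].
  by rewrite powRr1// mul1r subrr addr0.
have h := @conjugate_powR _ (s `^ th) 1 th^-1 (1 - th)^-1 (powR_ge0 _ _) ler01.
have := h ltac:(by rewrite invr_gt0) ltac:(by rewrite invr_gt0 subr_gt0).
rewrite !invrK mulr1 powR1 mul1r -powRrM divff ?gt_eqF// powRr1// addrC subrK => /(_ erefl).
by rewrite [s * _]mulrC [X in _ <= X]addrC.
Qed.

(** Wendel's inequality: apply [powR_le_chord] at s = t / x under the integral.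
    The mean of t against the Gamma density of parameter x is x, so the tangent
    line integrates to exactly eGamma x. *)
Lemma eGamma_wendel (x th : R) : 0 < x -> 0 <= th <= 1 ->
  (eGamma (x + th) <= (x `^ th)%:E * eGamma x)%E.
Proof.
move=> x0 th01; have [th0 th1] := andP th01.
(* x^th (th t / x + 1 - th) = k1 t + k2 is the tangent line of t^th at t = x. *)
pose k1 := x `^ th * (th / x); pose k2 := x `^ th * (1 - th).
have k10 : 0 <= k1 by rewrite mulr_ge0 ?powR_ge0// divr_ge0// ltW.
have k20 : 0 <= k2 by rewrite mulr_ge0 ?powR_ge0// subr_ge0.
have mg y : measurable_fun (`]0, +oo[%classic : set R) (fun t => (gamma_integrand y t)%:E).
  by apply/measurable_EFinP; exact: measurable_gamma_integrand.
have mkg (k y : R) : measurable_fun (`]0, +oo[%classic : set R)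
    (fun t => (k%:E * (gamma_integrand y t)%:E)%E).
  by apply: emeasurable_funM => //; exact: measurable_cst.
have -> : ((x `^ th)%:E * eGamma x = k1%:E * eGamma (x + 1) + k2%:E * eGamma x)%E.
  rewrite eGammaD1// muleA -EFinM -ge0_muleDl; last 2 first.
  - by rewrite lee_fin mulr_ge0// ltW.
  - by rewrite lee_fin.
  by rewrite -EFinD; congr (_%:E * _)%E; rewrite /k1 /k2; field; rewrite gt_eqF.
have iZ (k y : R) : 0 <= k ->
    (k%:E * eGamma y = \int[mu]_(t in `]0%R, +oo[) (k%:E * (gamma_integrand y t)%:E))%E.
  move=> k0; rewrite ge0_integralZl_EFin//; last exact: mg.
  by move=> t _; rewrite lee_fin gamma_integrand_ge0.
have kg0 (k y t : R) : 0 <= k -> (0 <= k%:E * (gamma_integrand y t)%:E)%E.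
  by move=> k0; rewrite -EFinM lee_fin mulr_ge0// gamma_integrand_ge0.
rewrite (iZ _ _ k10) (iZ _ _ k20) -ge0_integralD//; last 4 first.
- by move=> t _; exact: kg0.
- exact: mkg.
- by move=> t _; exact: kg0.
- exact: mkg.
apply: ge0_le_integral => //.
- by move=> t _; rewrite lee_fin gamma_integrand_ge0.
- exact: mg.
- by apply: emeasurable_funD; exact: mkg.
move=> t; rewrite /= in_itv/= andbT => t0.
rewrite -!EFinM -EFinD lee_fin gamma_integrandD1// mulrA -mulrDl.
have -> : gamma_integrand (x + th) t = t `^ th * gamma_integrand x t.
  rewrite /gamma_integrand mulrA -powRD; last by rewrite (gt_eqF t0) implybT.
  by congr (_ `^ _ * _); ring.
apply: ler_wpM2r; first exact: gamma_integrand_ge0.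
have -> : t `^ th = x `^ th * (t / x) `^ th.
  rewrite -powRM; [|exact: ltW|by rewrite divr_ge0// ltW].
  by congr (_ `^ _); field; rewrite gt_eqF.
rewrite (_ : k1 * t + k2 = x `^ th * (th * (t / x) + (1 - th))); last first.
  by rewrite /k1 /k2; field; rewrite gt_eqF.
by apply: ler_wpM2l; [exact: powR_ge0|apply: powR_le_chord => //; rewrite divr_ge0// ltW].
Qed.

(** eGamma is a factorial at positive integers; Wendel's inequality carries
    finiteness to all arguments x + 1, and the functional equation back to x. *)
Lemma eGamma_fin (x : R) : 0 < x -> eGamma x \is a fin_num.
Proof.
move=> x0.
have natfin n : eGamma n.+1%:R \is a fin_num.
  elim: n => [|n IHn]; first by rewrite eGamma1.
  by rewrite -(natr1 n.+1) eGammaD1// fin_numM.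
have [m /andP[mx xm]] : exists m, m%:R <= x < m%:R + 1.
  exists (Num.trunc x); rewrite natr1; apply: Num.Theory.truncn_itv; exact: ltW.
have fin1 : (eGamma (x + 1) < +oo)%E.
  have -> : x + 1 = m.+1%:R + (x - m%:R) by rewrite -natr1; ring.
  apply: le_lt_trans (eGamma_wendel _ _) _ => //; first lra.
  by rewrite ltey_eq fin_numM.
rewrite ge0_fin_numE ?eGamma_ge0// ltNge leye_eq; apply/negP => /eqP Goo.
by move: fin1; rewrite eGammaD1// Goo mulry gtr0_sg// mul1e.
Qed.

Lemma GammaE (x : R) : Gamma x = fine (eGamma x).
Proof. by []. Qed.

Lemma Gamma_EFin (x : R) : 0 < x -> (Gamma x)%:E = eGamma x.
Proof. by move=> x0; rewrite GammaE fineK// eGamma_fin. Qed.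

Lemma GammaD1 (x : R) : 0 < x -> Gamma (x + 1) = x * Gamma x.
Proof. by move=> x0; rewrite !GammaE eGammaD1// fineM// eGamma_fin. Qed.

Lemma Gamma1 : Gamma (1 : R) = 1.
Proof. by rewrite GammaE eGamma1. Qed.

Lemma Gamma_rising (x : R) n : 0 < x -> Gamma (x + n%:R) = rising x n * Gamma x.
Proof.
move=> x0; elim: n => [|n IHn]; first by rewrite addr0 /rising big_ord0 mul1r.
have xn : 0 < x + n%:R by rewrite ltr_wpDr.
by rewrite -natr1 addrA (GammaD1 xn) IHn risingS mulrCA mulrA.
Qed.

Lemma Gamma_wendel (x th : R) : 0 < x -> 0 <= th <= 1 -> Gamma (x + th) <= x `^ th * Gamma x.
Proof.
move=> x0 th01; have [th0 _] := andP th01.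
by rewrite -lee_fin EFinM !Gamma_EFin ?eGamma_wendel// ltr_wpDr.
Qed.

Lemma Gamma_natS n : Gamma (n.+1%:R : R) = n`!%:R.
Proof. by rewrite -natr1 addrC Gamma_rising// rising1 Gamma1 mulr1. Qed.

(** Wendel's inequality used twice: from n + 1 up to n + 1 + th gives the upper
    bound 1, and from n + 1 + th up to n + 2 the lower bound
    ((n + 1) / (n + 1 + th))^(1 - th) >= 1 - 1 / (n + 1). *)
Lemma Gamma_Gauss_product (th : R) : 0 < th <= 1 ->
  rising th n.+1 * Gamma th / (n.+1%:R `^ th * n`!%:R) @[n --> \oo] --> (1 : R).
Proof.
move=> /andP[th0 th1].
apply: (@squeeze_cvgr _ _ _ _ (fun n => 1 - n.+1%:R^-1) (fun=> 1)); last 2 first.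
- by have := cvgB (cvg_cst (1 : R)) (@cvg_harmonic R); rewrite subr0; exact.
- exact: cvg_cst.
apply: nearW => n.
have N0 : 0 < n.+1%:R :> R by rewrite ltr0n.
have f0 : 0 < n`!%:R :> R by rewrite ltr0n fact_gt0.
have p0 : 0 < n.+1%:R `^ th by rewrite powR_gt0.
have Nth : 0 < n.+1%:R + th by rewrite addr_gt0.
rewrite -Gamma_rising// [th + _]addrC ler_pdivlMr ?mulr_gt0// ler_pdivrMr ?mulr_gt0//.
rewrite mul1r -{2}Gamma_natS Gamma_wendel ?(ltW th0)// andbT.
have := @Gamma_wendel (n.+1%:R + th) (1 - th) Nth ltac:(lra).
rewrite (_ : n.+1%:R + th + (1 - th) = n.+2%:R); last by rewrite -[n.+2%:R]natr1; ring.
rewrite Gamma_natS factS natrM => W.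
set N : R := n.+1%:R in N0 p0 Nth W *.
have N1 : 1 <= N by rewrite ler1n.
pose r := N / (N + th).
have r0 : 0 < r by rewrite divr_gt0.
have rr : r <= r `^ (1 - th).
  apply: ger1_powR; last lra.
  by rewrite r0/= ler_pdivrMr// mul1r lerDl ltW.
have rN : 1 - N^-1 <= r.
  rewrite ler_pdivlMr// -(ler_pM2r N0).
  have -> : (1 - N^-1) * (N + th) * N = (N - 1) * (N + th) by field; rewrite gt_eqF.
  by nra.
have q0 : 0 < N `^ (1 - th) by rewrite powR_gt0.
have NE : N = N `^ (1 - th) * N `^ th.
  by rewrite -powRD ?(gt_eqF N0) ?implybT// subrK powRr1// ltW.
apply: le_trans (ler_wpM2r _ rN) _; first by rewrite mulr_ge0// ltW.
rewrite -(ler_pM2l q0).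
have -> : N `^ (1 - th) * (r * (N `^ th * n`!%:R)) = r * (N * n`!%:R).
  by rewrite [in RHS]NE; ring.
have -> : N `^ (1 - th) = r `^ (1 - th) * (N + th) `^ (1 - th).
  rewrite -powRM; [|exact: ltW|exact: ltW].
  by congr (_ `^ _); rewrite /r divfK ?gt_eqF.
rewrite -[leRHS]mulrA; apply: ler_pM => //; first exact: ltW.
by rewrite mulr_ge0// ltW.
Qed.

(** The substitution t = s^2. *)
Lemma gamma_sqr_subst (u v : R) : 0 < u -> u < v ->
  (\int[mu]_(t in `[(u ^+ 2)%R, (v ^+ 2)%R]) (gamma_integrand 2^-1%R t)%:E =
   2%:E * \int[mu]_(s in `[u, v]) (gauss_fun s)%:E)%E.
Proof.
move=> u0 uv.
have pos t : t \in `[u, v] -> 0 < t by rewrite in_itv/= => /andP[/(lt_le_trans u0)].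
pose F (s : R) := s ^+ 2.
have dF (s : R) : is_derive s 1 F (2 * s).
  by apply: is_derive_eq; rewrite /GRing.scale/=; ring.
have F'E : F^`()%classic = fun s => 2 * s.
  by apply/funext => s; rewrite derive1E; have [_ ->] := dF s.
have cF' : continuous (fun s : R => 2 * s).
  by move=> s; apply: cvgM; [exact: cvg_cst|exact: cvg_id].
rewrite -ge0_integralZl_EFin//; last 2 first.
- by move=> t _; rewrite lee_fin expR_ge0.
- by apply/measurable_EFinP; apply: measurable_funTS; exact: measurable_gauss_fun.
rewrite (@integration_by_substitution_increasing _ F (gamma_integrand 2^-1) u v (ltW uv)).
- apply: eq_integral => s; rewrite inE/= => /pos s0.
  rewrite F'E -EFinM fctE /gamma_integrand /gauss_fun /F; congr EFin.
  have -> : 2^-1 - 1 = - 2^-1 :> R by field.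
  rewrite /= powRN powR12_sqrt ?sqr_ge0// sqrtr_sqr gtr0_norm//.
  by field; rewrite gt_eqF.
- by move=> s t /pos s0 /pos t0 st; rewrite /F ltrXn2r ?nnegrE ?ltW.
- by rewrite F'E => s _; exact: cF'.
- by rewrite F'E; apply/cvg_ex; exists (2 * u); apply: cvg_at_right_filter; exact: cF'.
- by rewrite F'E; apply/cvg_ex; exists (2 * v); apply: cvg_at_left_filter; exact: cF'.
- by apply: derivable_oo_LR => // s _; have [] := dF s.
apply: continuous_in_subspaceT => t; rewrite inE/= in_itv/= => /andP[ut _].
apply: cvgM; first by apply: continuous_powR; rewrite (lt_le_trans _ ut)// exprn_gt0.
by apply: continuous_comp; [exact: continuousN|exact: continuous_expR].
Qed.

Lemma Gamma_half : Gamma (2^-1 : R) = Num.sqrt pi.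
Proof.
pose b n := n.+2%:R : R.
have b1 n : 1 < b n by rewrite ltr1n.
have b0 n : 0 < b n by rewrite ltr0n.
have nb : nondecreasing_seq b by move=> m n mn; rewrite ler_nat !ltnS.
have boo : b @ \oo --> +oo.
  apply/cvgryPge => A; near=> n; apply: (@le_trans _ _ n%:R); last by rewrite ler_nat ltnW// ltnW.
  by near: n; exact: nbhs_infty_ger.
pose c n := b n ^+ 2.
have c0 n : 0 < c n by rewrite exprn_gt0.
have nc : nondecreasing_seq c.
  by move=> m n mn; apply: lerXn2r; rewrite ?nnegrE ?(ltW (b0 _))//; exact: nb.
have coo : c @ \oo --> +oo.
  by apply: (cvg_comp b (fun x => x ^+ 2) boo); exact: cvgr_expr2.
have e1 := @cvg_integral_exhaust (gamma_integrand 2^-1) c (@measurable_gamma_integrand 2^-1 setT)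
  (gamma_integrand_ge0 2^-1) nc c0 coo.
have e2 := @cvg_integral_exhaust gauss_fun b (@measurable_gauss_fun R)
  (@gauss_fun_ge0 R) nb b0 boo.
suff -> : Gamma (2^-1 : R) = fine (2%:E * (Num.sqrt pi / 2)%:E)%E.
  by rewrite /=; field.
rewrite GammaE; congr fine; apply: (cvg_unique _ e1) => //.
have -> : (fun n => \int[mu]_(t in `[(c n)^-1%R, c n]) (gamma_integrand 2^-1 t)%:E)%E =
  (fun n => 2%:E * \int[mu]_(s in `[(b n)^-1%R, b n]) (gauss_fun s)%:E)%E.
  apply/funext => n; rewrite /c -exprVn gamma_sqr_subst ?invr_gt0//.
  by rewrite (@lt_trans _ _ 1)// invf_lt1.
rewrite -integral0y_gauss -integral_itv_obnd_cbnd; last first.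
  by apply/measurable_EFinP; apply: measurable_funTS; exact: measurable_gauss_fun.
exact: cvgeZl.
Unshelve. end_near. Qed.

End Gamma.

(** * Bailey's sum at one half *)

(** The k-th term of F(a, 1 - a; c; 1/2).  The parameter c, which is 1 in the
    theorem, is the one that the contiguity relation moves. *)
Definition bailey_term (R : realType) (a c : R) k :=
  rising a k * rising (1 - a) k / (rising c k * k`!%:R) / 2 ^+ k.

Section bailey_term.
Context {R : realType} (a : R) (a01 : 0 < a < 1).

Let le_rising1 (x : R) n : 0 <= x <= 1 -> rising x n <= n`!%:R.
Proof.
move=> /andP[x0 x1]; rewrite -rising1; apply: ler_prod => i _.
by rewrite addr_ge0//= lerD2r.
Qed.

(** A factor c remains after comparison with a factorial, so all terms but the first are O(1/c). *)
Let ge_rising (c : R) n : 1 <= c -> c * n.+1`!%:R <= rising c n.+1.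
Proof.
move=> c1; elim: n => [|n IHn]; first by rewrite risingS /rising big_ord0 addr0 mulr1 mul1r.
rewrite risingS factS mulnC natrM mulrA; apply: ler_pM => //.
- by rewrite mulr_ge0//; lra.
- by rewrite -natr1 addrC lerD2r.
Qed.

Lemma bailey_term_ge0 (c : R) k : 0 < c -> 0 <= bailey_term a c k.
Proof.
move=> c0; have [a0 a1] := andP a01.
by rewrite /bailey_term !(mulr_ge0, invr_ge0, exprn_ge0)// ltW// rising_gt0// subr_gt0.
Qed.

Lemma bailey_term0 (c : R) : bailey_term a c 0 = 1.
Proof. by rewrite /bailey_term /rising !big_ord0 expr0 !(mulr1, invr1). Qed.

Lemma bailey_termS_le (c : R) k : 1 <= c -> bailey_term a c k.+1 <= c^-1 * 2^-1 ^+ k.+1.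
Proof.
move=> c1; have [a0 a1] := andP a01.
have c0 : 0 < c by lra.
have f0 : 0 < k.+1`!%:R :> R by rewrite ltr0n fact_gt0.
rewrite /bailey_term exprVn ler_wpM2r// ler_pdivrMr ?mulr_gt0 ?rising_gt0// mulrA.
apply: (@le_trans _ _ (k.+1`!%:R * k.+1`!%:R)).
  by apply: ler_pM; rewrite ?(ltW (rising_gt0 _ _))//; try apply: le_rising1; lra.
by rewrite ler_wpM2r// ?ler0n// mulrC ler_pdivlMr// mulrC ge_rising.
Qed.

(** Since t_k <= 2^-k / c for k > 0, the sum is 1 + O(1/c): the same estimate gives
    convergence and the limit as c grows. *)
Lemma series_bailey_bound (c : R) N : 1 <= c ->
  1 <= series (bailey_term a c) N.+1 <= 1 + c^-1.
Proof.
move=> c1; rewrite /series/= big_nat_recl// bailey_term0.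
have c0 : 0 < c by lra.
apply/andP; split; first by rewrite lerDl sumr_ge0// => i _; apply: bailey_term_ge0; lra.
rewrite lerD2l.
have -> : c^-1 = c^-1 * (2^-1 ^+ N + \sum_(0 <= i < N) 2^-1 ^+ i.+1).
  rewrite -[LHS]mulr1; congr (_ * _).
  elim: N => [|N IHN]; first by rewrite big_geq// addr0 expr0.
  by rewrite big_nat_recr//= {1}IHN exprS; field.
rewrite mulrDr -[leLHS]add0r lerD ?mulr_ge0 ?invr_ge0 ?exprn_ge0 ?(ltW c0)//.
by rewrite mulr_sumr; apply: ler_sum => i _; exact: bailey_termS_le.
Qed.

Lemma is_cvg_series_bailey (c : R) : 1 <= c -> cvgn (series (bailey_term a c)).
Proof.
move=> c1; have c0 : 0 < c by lra.
apply: nondecreasing_is_cvgn.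
  by apply/nondecreasing_seqP => n; rewrite seriesSr lerDl; exact: bailey_term_ge0.
exists (1 + c^-1) => _ [[|n] _ <-].
  by rewrite /series/= big_geq// addr_ge0// invr_ge0 ltW.
by have /andP[] := series_bailey_bound n c1.
Qed.

Definition bailey_sum (c : R) := limn (series (bailey_term a c)).

Lemma bailey_sum_bound (c : R) : 1 <= c -> 1 <= bailey_sum c <= 1 + c^-1.
Proof.
move=> c1; have cv := is_cvg_series_bailey c1.
apply/andP; split; [apply: limr_ge cv _|apply: limr_le cv _];
  by exists 1%N => // -[//|N] _; have /andP[] := series_bailey_bound N c1.
Qed.

(** The certificate: with t_k = [bailey_term a c k] and G_k = - 2 k t_k / (c + k),
    G_(k+1) - G_k = t_k (1 - (c + a) (c + 1 - a) / ((c + k) (c + k + 1))),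
    and c (c + 1) t_k / ((c + k) (c + k + 1)) is the k-th term for c + 2. *)
Lemma bailey_telescope (c : R) N : 0 < c ->
  c * (c + 1) * series (bailey_term a c) N -
    (c + a) * (c + 1 - a) * series (bailey_term a (c + 2)) N =
  - (2 * c * (c + 1)) * (N%:R / (c + N%:R) * bailey_term a c N).
Proof.
move=> c0.
elim: N => [|N IHN]; first by rewrite /series/= !big_geq// !mul0r !mulr0 subrr.
have regroup (x y s t p q : R) :
  x * (s + p) - y * (t + q) = (x * s - y * t) + (x * p - y * q) by ring.
rewrite !seriesSr regroup IHN.
have N0 : 0 <= N%:R :> R by [].
have -> : bailey_term a (c + 2) N = c * (c + 1) / ((c + N%:R) * (c + N%:R + 1)) * bailey_term a c N.
  have rc : 0 < rising c N by exact: rising_gt0.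
  rewrite /bailey_term.
  have -> : rising (c + 2) N = rising c N * (c + N%:R) * (c + N%:R + 1) / (c * (c + 1)).
    rewrite -rising_addr2; field; rewrite !gt_eqF//; lra.
  field; rewrite ?expf_neq0 ?pnatr_eq0 -?lt0n ?fact_gt0//= !gt_eqF//; lra.
have -> : bailey_term a c N.+1 =
    (a + N%:R) * (1 - a + N%:R) / (2 * (c + N%:R) * (N%:R + 1)) * bailey_term a c N.
  have rc : 0 < rising c N by exact: rising_gt0.
  rewrite /bailey_term !risingS factS natrM -(natr1 N) exprS.
  field; rewrite ?expf_neq0 ?pnatr_eq0 -?lt0n ?fact_gt0//= !gt_eqF//; lra.
rewrite -natr1; field; rewrite !gt_eqF//; lra.
Qed.

Lemma bailey_sum_contiguous (c : R) : 1 <= c ->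
  c * (c + 1) * bailey_sum c = (c + a) * (c + 1 - a) * bailey_sum (c + 2).
Proof.
move=> c1; have [a0 a1] := andP a01; have c0 : 0 < c by lra.
have cv1 := is_cvg_series_bailey c1; have cv2 : cvgn (series (bailey_term a (c + 2))).
  by apply: is_cvg_series_bailey; lra.
apply/eqP; rewrite -subr_eq0; apply/eqP.
pose d N := c * (c + 1) * series (bailey_term a c) N -
  (c + a) * (c + 1 - a) * series (bailey_term a (c + 2)) N.
apply: (@cvg_unique _ (@Rhausdorff R) (d @ \oo)).
  by apply: cvgB; apply: cvgM => //; exact: cvg_cst.
have t0 := cvg_series_cvg_0 cv1.
apply: cvg_trans (_ : (fun N =>
    - (2 * c * (c + 1)) * (N%:R / (c + N%:R) * bailey_term a c N)) @ \oo --> 0).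
  by apply: near_eq_cvg; apply: nearW => N; rewrite /d bailey_telescope.
suff h : (fun N => N%:R / (c + N%:R) * bailey_term a c N) @ \oo --> 0.
  by have := cvgM (cvg_cst (- (2 * c * (c + 1)))) h; rewrite mulr0; exact.
apply: (@squeeze_cvgr _ _ _ _ (fun=> 0) (bailey_term a c)) => //; last exact: cvg_cst.
apply: nearW => N; have N0 : 0 <= N%:R :> R by [].
have cN : 0 < c + N%:R by lra.
have h0 := bailey_term_ge0 N c0.
have r0 : 0 <= N%:R / (c + N%:R) by rewrite divr_ge0// ltW.
by rewrite mulr_ge0//= ler_piMl// ler_pdivrMr//; lra.
Qed.

(** Iterating the contiguity relation from c = 1 in steps of 2; halving all
    factors turns the products into rising factorials. *)
Lemma bailey_sum1 n :
  rising 2^-1 n * n`!%:R * bailey_sum 1 =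
  rising ((1 + a) / 2) n * rising (1 - a / 2) n * bailey_sum (1 + 2 * n%:R).
Proof.
elim: n => [|n IHn]; first by rewrite /rising !big_ord0 mulr0 addr0.
have n0 : 0 <= n%:R :> R by [].
have := @bailey_sum_contiguous (1 + 2 * n%:R) ltac:(lra).
rewrite (_ : 1 + 2 * n%:R + 2 = 1 + 2 * n.+1%:R); last by rewrite -(natr1 n); ring.
move=> H.
transitivity ((2^-1 + n%:R) * (n%:R + 1) * (rising 2^-1 n * n`!%:R * bailey_sum 1)).
  by rewrite risingS factS natrM -(natr1 n); ring.
rewrite IHn !risingS.
transitivity (rising ((1 + a) / 2) n * rising (1 - a / 2) n / 4 *
   ((1 + 2 * n%:R) * (1 + 2 * n%:R + 1) * bailey_sum (1 + 2 * n%:R))); first by field.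
by rewrite H; field.
Qed.

Lemma cvg_bailey_sum : bailey_sum (1 + 2 * n%:R) @[n --> \oo] --> (1 : R).
Proof.
apply: (@squeeze_cvgr _ _ _ _ (fun=> 1) (fun n => 1 + (1 + 2 * n%:R)^-1)).
- apply: nearW => n; apply: bailey_sum_bound.
  by have : 0 <= n%:R :> R by []; lra.
- exact: cvg_cst.
- rewrite -[X in _ --> X]addr0; apply: cvgD; first exact: cvg_cst.
  apply: (@squeeze_cvgr _ _ _ _ (fun=> 0) harmonic); [|exact: cvg_cst|exact: cvg_harmonic].
  apply: nearW => n; have n0 : 0 <= n%:R :> R by [].
  rewrite invr_ge0 /harmonic/= -natr1 lef_pV2 ?posrE; lra.
Qed.

End bailey_term.

(** Let n grow in [bailey_sum1] with every rising factorial normalised as in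
    Gauss's product.  The powers of n cancel because
    (1 + a)/2 + (1 - a/2) = 1/2 + 1. *)
Lemma bailey_sum_Gamma (R : realType) (a : R) : 0 < a < 1 ->
  bailey_sum a 1 * (Gamma ((1 + a) / 2) * Gamma (1 - a / 2)) = Num.sqrt pi.
Proof.
move=> a01; have [a0 a1] := andP a01.
set p := (1 + a) / 2; set q := 1 - a / 2.
pose w (th : R) n := rising th n.+1 * Gamma th / (n.+1%:R `^ th * n`!%:R).
have wcv (th : R) : 0 < th <= 1 -> w th @ \oo --> (1 : R) by exact: Gamma_Gauss_product.
have wE n : w 2^-1 n * w 1 n * (bailey_sum a 1 * (Gamma p * Gamma q)) =
    w p n * w q n * (Gamma 2^-1 * bailey_sum a (1 + 2 * n.+1%:R)).
  have N0 : n.+1%:R != 0 :> R by rewrite pnatr_eq0.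
  have f0 : n`!%:R != 0 :> R by rewrite pnatr_eq0 -lt0n fact_gt0.
  have H := bailey_sum1 a01 n.+1; rewrite -/p -/q in H.
  have E : n.+1%:R `^ 2^-1 * n.+1%:R `^ 1 = n.+1%:R `^ p * n.+1%:R `^ q :> R.
    rewrite -!powRD ?N0 ?implybT//; by congr (_ `^ _); rewrite /p /q; field.
  have P0 (th : R) : n.+1%:R `^ th != 0 :> R by rewrite powR_eq0 (negbTE N0).
  pose K : R := Gamma 2^-1 * (Gamma p * Gamma q) / n`!%:R ^+ 2.
  transitivity (K / (n.+1%:R `^ 2^-1 * n.+1%:R `^ 1) *
      (rising 2^-1 n.+1 * n.+1`!%:R * bailey_sum a 1)).
    rewrite /w /K Gamma1 -(rising1 R n.+1).
    move: (P0 2^-1) (P0 1); move: (n.+1%:R `^ 2^-1 : R) (n.+1%:R `^ 1 : R) => P Q P0' Q0'.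
    move: (Gamma 2^-1) (Gamma p) (Gamma q) (bailey_sum a 1) => g gp gq s.
    by field; rewrite f0 P0' Q0'.
  rewrite H E /w /K.
  move: (P0 p) (P0 q); move: (n.+1%:R `^ p : R) (n.+1%:R `^ q : R) => P Q P0' Q0'.
  move: (Gamma 2^-1) (Gamma p) (Gamma q) (bailey_sum a _) => g gp gq s.
  by field; rewrite f0 P0' Q0'.
have half01 : 0 < (2^-1 : R) <= 1 by lra.
have p01 : 0 < p <= 1 by rewrite /p; lra.
have q01 : 0 < q <= 1 by rewrite /q; lra.
have one01 : 0 < (1 : R) <= 1 by lra.
have hS : bailey_sum a (1 + 2 * n.+1%:R) @[n --> \oo] --> (1 : R).
  by have := cvg_bailey_sum a01; rewrite -cvg_shiftS.
have lhs : w 2^-1 n * w 1 n * (bailey_sum a 1 * (Gamma p * Gamma q)) @[n --> \oo] -->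
    1 * 1 * (bailey_sum a 1 * (Gamma p * Gamma q)).
  by apply: cvgM (cvg_cst _); exact: cvgM (wcv _ half01) (wcv _ one01).
have rhs : w p n * w q n * (Gamma 2^-1 * bailey_sum a (1 + 2 * n.+1%:R)) @[n --> \oo] -->
    1 * 1 * (Gamma (2^-1 : R) * 1).
  by apply: cvgM (cvgM (cvg_cst _) hS); exact: cvgM (wcv _ p01) (wcv _ q01).
rewrite (funext wE) in lhs.
have := cvg_unique (@Rhausdorff R) lhs rhs.
by rewrite !mul1r mulr1 Gamma_half; apply.
Qed.

(** * Harmonic numbers as logarithmic derivatives *)

Lemma harmonic_numberS (R : realType) n :
  harmonic_number R n.+1 = harmonic_number R n + (n%:R + 1)^-1.
Proof. by rewrite /harmonic_number big_nat_recr//= natr1. Qed.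

(** F(a, 1 - a; 1; (1 - z)/2) is the Legendre function of degree - a at z. *)
Definition legendre_coef (R : realType) (a : R) n :=
  rising a n * rising (1 - a) n / n`!%:R ^+ 2.
(** The derivative of log ((a + e)_n (1 - a + e)_n) with respect to e at e = 0. *)
Definition rising_dlog (R : realType) (a : R) n :=
  \sum_(j < n) ((a + j%:R)^-1 + (1 - a + j%:R)^-1).

Lemma legendre_coefS (R : realType) (a : R) n :
  (n%:R + 1) ^+ 2 * legendre_coef a n.+1 = (a + n%:R) * (1 - a + n%:R) * legendre_coef a n.
Proof.
rewrite /legendre_coef !risingS factS natrM -(natr1 n).
have n0 : n`!%:R != 0 :> R by rewrite pnatr_eq0 -lt0n fact_gt0.
have n1 : n%:R + 1 != 0 :> R by rewrite natr1 pnatr_eq0.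
by field; rewrite n0 n1.
Qed.

Lemma bailey_term1 (R : realType) (a : R) n : bailey_term a 1 n = legendre_coef a n / 2 ^+ n.
Proof. by rewrite /bailey_term /legendre_coef rising1 expr2. Qed.

(** The product of binomials is (6k)! / (k! (2k)! (3k)!); passing from k to k + 1,
    all linear factors of (6k + 6)! but those of 1/6 and 5/6 cancel. *)
Lemma binomial_legendre_coef (R : realType) k :
  'C(3 * k, k)%:R * 'C(6 * k, 3 * k)%:R = 432 ^+ k * legendre_coef (1 / 6) k :> R.
Proof.
have fact_neq0 n : n`!%:R != 0 :> R by rewrite pnatr_eq0 -lt0n fact_gt0.
have E1 : 'C(3 * k, k)%:R * 'C(6 * k, 3 * k)%:R * (k`! * (2 * k)`! * (3 * k)`!)%:R
          = (6 * k)`!%:R :> R.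
  have e1 : (6 * k - 3 * k = 3 * k)%N by rewrite -mulnBl.
  have e2 : (3 * k - k = 2 * k)%N by rewrite -{2}[k]mul1n -mulnBl.
  have := @bin_fact (6 * k) (3 * k); rewrite e1 leq_mul2r orbT => /(_ isT) <-.
  have := @bin_fact (3 * k) k; rewrite e2 leq_pmull// => /(_ isT) /(congr1 (fun m => m%:R : R)).
  by rewrite !natrM => <-; ring.
suff E2 : 432 ^+ k * legendre_coef (1 / 6) k * (k`! * (2 * k)`! * (3 * k)`!)%:R
          = (6 * k)`!%:R :> R.
  apply: (mulIf (x := (k`! * (2 * k)`! * (3 * k)`!)%:R)); last by rewrite E1 E2.
  by rewrite !natrM !mulf_neq0.
elim: k {E1} => [|k IHk]; first by rewrite /legendre_coef /rising !big_ord0 !muln0 !fact0; field.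
rewrite !mulnS ![(_ + _ * k)%N]/= !addSn !add0n !factS.
have k1 : k%:R + 1 != 0 :> R by rewrite natr1 pnatr_eq0.
have -> : legendre_coef (1 / 6) k.+1 =
    (1 / 6 + k%:R) * (5 / 6 + k%:R) / (k%:R + 1) ^+ 2 * legendre_coef (1 / 6) k :> R.
  by apply: (mulfI (expf_neq0 2 k1)); rewrite legendre_coefS; field.
rewrite !natrM -(natr1 (6 * k).+4.+1) -(natr1 (6 * k).+4) -(natr1 (6 * k).+3)
  -(natr1 (6 * k).+2) -(natr1 (6 * k).+1) -(natr1 (6 * k))
  -(natr1 (3 * k).+2) -(natr1 (3 * k).+1) -(natr1 (3 * k))
  -(natr1 (2 * k).+1) -(natr1 (2 * k)) -(natr1 k).
rewrite -IHk !natrM exprS.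
move: (legendre_coef (1 / 6 : R) k) => h.
by field.
Qed.

(** Of the six new terms of H_(6k), the multiples of 2 and 3 are cancelled by the
    terms of H_(3k), H_(2k) and H_k; the residues 1 and 5 modulo 6 survive. *)
Lemma harmonic_rising_dlog (R : realType) k :
  6 * harmonic_number R (6 * k)%N - 3 * harmonic_number R (3 * k)%N
     - 2 * harmonic_number R (2 * k)%N + harmonic_number R k = rising_dlog (1 / 6) k.
Proof.
elim: k => [|k IHk].
  by rewrite !muln0 /harmonic_number /rising_dlog !big_geq// big_ord0; ring.
rewrite /rising_dlog big_ord_recr/= -/(rising_dlog _ _) -IHk.
rewrite !mulnS !addSn !add0n !harmonic_numberS
  -(natr1 (6 * k).+4) -(natr1 (6 * k).+3) -(natr1 (6 * k).+2)
  -(natr1 (6 * k).+1) -(natr1 (6 * k)) -(natr1 (3 * k).+1) -(natr1 (3 * k)) -(natr1 (2 * k)) !natrM.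
have k0 : 0 <= k%:R :> R by [].
move: (k%:R : R) (harmonic_number R (6 * k)) (harmonic_number R (3 * k))
  (harmonic_number R (2 * k)) (harmonic_number R k) k0 => x h6 h3 h2 h1 x0.
(* All reciprocals are brought to the six denominators x + 1 and 6 x + i,
   i = 1, ..., 5, after which the identity is linear in them. *)
have inv c y z : 0 < z -> y = c * z -> y^-1 = c^-1 * z^-1 :> R by move=> _ ->; rewrite invfM.
rewrite (inv 2^-1 (3 * x + 1) (6 * x + 1 + 1)); [|lra..].
rewrite (inv 2^-1 (3 * x + 1 + 1) (6 * x + 1 + 1 + 1 + 1)); [|lra..].
rewrite (inv 3 (3 * x + 1 + 1 + 1) (x + 1)); [|lra..].
rewrite (inv 3^-1 (2 * x + 1) (6 * x + 1 + 1 + 1)); [|lra..].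
rewrite (inv 2 (2 * x + 1 + 1) (x + 1)); [|lra..].
rewrite (inv 6 (6 * x + 1 + 1 + 1 + 1 + 1 + 1) (x + 1)); [|lra..].
rewrite (inv 6^-1 (1 / 6 + x) (6 * x + 1)); [|lra..].
rewrite (inv 6^-1 (1 - 1 / 6 + x) (6 * x + 1 + 1 + 1 + 1 + 1)); [|lra..].
rewrite !invrK.
set u1 := (x + 1)^-1; set u2 := (6 * x + 1)^-1; set u3 := (6 * x + 1 + 1 + 1 + 1 + 1)^-1.
set u4 := (6 * x + 1 + 1)^-1; set u5 := (6 * x + 1 + 1 + 1)^-1.
set u6 := (6 * x + 1 + 1 + 1 + 1)^-1.
by clearbody u1 u2 u3 u4 u5 u6; field.
Qed.

(** * The harmonic factor as a convolution *)

(** Let d_n be the right-hand side.  In (n + 1)^2 d_(n+1) write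
    (n + 1)^2 = m (m + 2k) + k^2 with m = n + 1 - k, and lower the index of
    k^2 c_k by [legendre_coefS].  As (n + a)(n + 1 - a) - (k + a)(k + 1 - a) =
    (n - k)(n + k + 1), comparison with (n + a)(n + 1 - a) d_n leaves only
    (2n + 1) c_n: the recurrence that the left-hand side visibly satisfies. *)
Lemma legendre_coef_dlog (R : realType) (a : R) n : 0 < a < 1 ->
  legendre_coef a n * rising_dlog a n = \sum_(k < n) legendre_coef a k / (n - k)%:R.
Proof.
move=> /andP[a0 a1].
elim: n => [|n IHn]; first by rewrite /rising_dlog !big_ord0 mulr0.
have n1 : (n%:R + 1) ^+ 2 != 0 :> R by rewrite natr1 expf_neq0// pnatr_eq0.
have n0 : 0 <= n%:R :> R by [].
have rec : (n%:R + 1) ^+ 2 * (\sum_(k < n.+1) legendre_coef a k / (n.+1 - k)%:R) =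
    (a + n%:R) * (1 - a + n%:R) * (\sum_(k < n) legendre_coef a k / (n - k)%:R)
    + (2 * n%:R + 1) * legendre_coef a n.
  have split k : (k <= n)%N -> (n%:R + 1) ^+ 2 * (legendre_coef a k / (n.+1 - k)%:R) =
      legendre_coef a k * (n%:R + 1 + k%:R) + k%:R ^+ 2 * legendre_coef a k / (n.+1 - k)%:R.
    move=> kn.
    have nz : n%:R + 1 - k%:R != 0 :> R.
      by rewrite natr1 -natrB ?(leq_trans kn)// pnatr_eq0 subn_eq0 -ltnNge ltnS.
    by rewrite natrB ?(leq_trans kn)// -natr1; field.
  rewrite mulr_sumr.
  under eq_bigr => k _ do rewrite (split k (leq_ord k)).
  rewrite big_split/= big_ord_recr/= [X in _ + X]big_ord_recl/= expr0n/= mul0r mul0r add0r.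
  rewrite addrAC -big_split/= mulr_sumr; congr (_ + _); last by ring.
  apply: eq_bigr => -[k kn] _ /=.
  rewrite /bump leq0n add1n subSS -(natr1 k).
  rewrite legendre_coefS natrB 1?ltnW//.
  have nz : n%:R - k%:R != 0 :> R by rewrite -natrB 1?ltnW// pnatr_eq0 subn_eq0 -ltnNge.
  by field.
apply: (mulfI n1); rewrite rec -IHn [LHS]mulrA legendre_coefS /rising_dlog big_ord_recr/=.
by field; rewrite !gt_eqF//; lra.
Qed.

(** For nonnegative terms, the triangle of indices k + m < n lies between the
    squares of side n/2 and n. *)
Lemma series_cauchy_prod (R : realType) (u v : R^nat) (U V : R) :
  (forall n, 0 <= u n) -> (forall n, 0 <= v n) ->
  series u @ \oo --> U -> series v @ \oo --> V ->
  series (fun n => \sum_(k < n.+1) u k * v (n - k)%N) @ \oo --> U * V.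
Proof.
move=> u0 v0 uU vV.
have CE N : series (fun n => \sum_(k < n.+1) u k * v (n - k)%N) N =
    \sum_(k < N) u k * series v (N - k)%N.
  elim: N => [|N IHN]; first by rewrite /series/= big_geq// big_ord0.
  rewrite seriesSr IHN.
  transitivity (\sum_(k < N.+1) u k * series v (N - k)%N
     + \sum_(k < N.+1) u k * v (N - k)%N).
    by rewrite [X in _ = X + _]big_ord_recr/= subnn /series/= [in RHS]big_geq// mulr0 addr0.
  rewrite -big_split; apply: eq_bigr => k _ /=.
  by rewrite -mulrDr subSn ?leq_ord// seriesSr.
have le_series (w : R^nat) m n : (forall n, 0 <= w n) -> (m <= n)%N ->
    series w m <= series w n.
  by move=> w0; apply/nondecreasing_seqP: m n => n; rewrite seriesSr lerDl.
have half : (fun n => n./2) @ \oo --> \oo.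
  move=> A [N _ AN]; exists N.*2 => // n /= Nn; apply: AN => /=.
  by rewrite -(doubleK N); apply: half_leq.
apply: (@squeeze_cvgr _ _ _ _ (fun n => series u n./2 * series v n./2)
  (fun n => series u n * series v n)).
- apply: nearW => n; rewrite CE; apply/andP; split.
    rewrite -(big_mkord xpredT (fun k => u k * series v (n - k)%N)).
    rewrite (big_cat_nat (n := n./2))//=; last by lia.
    apply: (@le_trans _ _ (\sum_(0 <= k < n./2) u k * series v (n - k)%N)); last first.
      by rewrite lerDl; apply: sumr_ge0 => k _; rewrite mulr_ge0// sumr_ge0.
    rewrite [X in X * _ <= _]/series/= mulr_suml !big_mkord; apply: ler_sum => k _.
    by apply: ler_wpM2l => //; apply: le_series => //; have := ltn_ord k; lia.
  rewrite [X in _ <= X * _]/series/= big_mkord mulr_suml; apply: ler_sum => k _.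
  by apply: ler_wpM2l => //; apply: le_series => //; exact: leq_subr.
- by apply: cvgM; [apply: cvg_comp half uU|apply: cvg_comp half vV].
- exact: cvgM.
Qed.

(** The remainder D_N of the Taylor expansion of - ln (1 - x) has derivative
    x^N / (1 - x), so D_N(1/2) is at most 2^-N by the mean value theorem.  The
    term of index 0 is 0, since 0 is its own inverse. *)
Lemma series_ln2 (R : realType) :
  series (fun n => n%:R^-1 / 2 ^+ n : R) @ \oo --> (ln 2 : R).
Proof.
pose D N (x : R) := - ln (1 - x) - \sum_(k < N) x ^+ k.+1 / k.+1%:R.
have DS N (x : R) : D N.+1 x = D N x - x ^+ N.+1 / N.+1%:R.
  by rewrite /D big_ord_recr/= opprD addrA.
have D0 N : D N 0 = 0.
  rewrite /D subr0 ln1 oppr0 add0r big1 ?oppr0// => k _.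
  by rewrite expr0n/= mul0r.
have dD N (x : R) : x < 1 -> is_derive x 1 (D N) (x ^+ N / (1 - x)).
  move=> x1; elim: N => [|N IHN].
    have -> : D 0%N = \- (@ln R \o (fun x => 1 - x)).
      by apply/funext => y; rewrite /D big_ord0 subr0.
    have dln : is_derive (1 - x) 1 (@ln R) (1 - x)^-1 by apply: is_derive1_ln; lra.
    by apply: is_derive_eq; rewrite expr0; field; rewrite gt_eqF// subr_gt0.
  have -> : D N.+1 = D N - (N.+1%:R^-1 \*: (id : R -> R) ^+ N.+1).
    by apply/funext => y; rewrite DS mulrC !fctE; exact: erefl.
  apply: is_derive_eq.
  have N1 : N.+1%:R != 0 :> R by rewrite pnatr_eq0.
  rewrite /GRing.scale/= mulr1 exprS.
  by field; rewrite nat1r N1 andbT gt_eqF// subr_gt0.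
have bd N : 0 <= D N 2^-1 <= 2^-1 ^+ N.
  have [|||c] := @MVT R (D N) (fun x => x ^+ N / (1 - x)) 0 2^-1.
  - by rewrite invr_gt0.
  - by move=> x; rewrite in_itv/= => /andP[_ xh]; apply: dD; lra.
  - apply: derivable_within_continuous => x; rewrite in_itv/= => /andP[_ xh].
    by have [] := dD N x ltac:(lra).
  rewrite D0 !subr0 in_itv/= => /andP[c0 c1] ->.
  have c2 : 0 < 1 - c by lra.
  apply/andP; split; first by rewrite !mulr_ge0 ?invr_ge0 ?exprn_ge0// ltW.
  rewrite -mulrA -[leRHS]mulr1; apply: ler_pM.
  - by rewrite exprn_ge0// ltW.
  - by rewrite mulr_ge0 ?invr_ge0// ltW.
  - by rewrite lerXn2r ?nnegrE ?invr_ge0 1?ltW.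
  - by rewrite mulrC ler_pdivrMr// mul1r; lra.
have D2 N : series (fun n => n%:R^-1 / 2 ^+ n : R) N.+1 = ln 2 - D N 2^-1.
  rewrite /D /series/= big_nat_recl// invr0 mul0r add0r.
  have -> : 1 - 2^-1 = 2^-1 :> R by field.
  rewrite lnV ?posrE// opprK opprB addrC subrK big_mkord.
  by apply: eq_bigr => k _; rewrite exprVn mulrC.
have Dcv : D N 2^-1 @[N --> \oo] --> (0 : R).
  apply: (@squeeze_cvgr _ _ _ _ (fun=> 0) (fun N => 2^-1 ^+ N)).
  - exact: nearW.
  - exact: cvg_cst.
  - by apply: cvg_expr; rewrite ger0_norm ?invr_ge0// invf_lt1// ltr1n.
rewrite -cvg_shiftS.
suff -> : [sequence series (fun n => n%:R^-1 / 2 ^+ n : R) n.+1]_n = (fun N => ln 2 - D N 2^-1).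
  by have := cvgB (cvg_cst (ln 2 : R)) Dcv; rewrite subr0; exact.
by apply/funext => N; rewrite /= D2.
Qed.

(** * Evaluation of the series *)

Theorem theorem1p3 (R : realType) :
  series (fun k : nat =>
    ('C((3 * k)%N, k)%:R * 'C((6 * k)%N, (3 * k)%N)%:R) / 864 ^+ k *
    (6 * harmonic_number R (6 * k)%N - 3 * harmonic_number R (3 * k)%N
     - 2 * harmonic_number R (2 * k)%N + harmonic_number R k) : R) @ \oo -->
  ln 2 * Num.sqrt pi / (Gamma (7 / 12) * Gamma (11 / 12)).
Proof.
have a01 : 0 < (1 / 6 : R) < 1 by lra.
have FG := bailey_sum_Gamma a01.
rewrite (_ : (1 + 1 / 6) / 2 = 7 / 12) in FG; last by field.
rewrite (_ : 1 - 1 / 6 / 2 = 11 / 12) in FG; last by field.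
have G0 : Gamma (7 / 12) * Gamma (11 / 12) != 0 :> R.
  apply/eqP => G0; move: FG; rewrite G0 mulr0 => /esym/eqP.
  by rewrite sqrtr_eq0 leNgt pi_gt0.
rewrite -FG mulrA mulfK// [ln 2 * _]mulrC.
pose conv n : R := \sum_(k < n.+1) bailey_term (1 / 6) 1 k * ((n - k)%:R^-1 / 2 ^+ (n - k)).
have cauchy : series conv @ \oo --> (bailey_sum (1 / 6) 1 * ln 2 : R).
  apply: (@series_cauchy_prod R (bailey_term (1 / 6) 1) (fun n => n%:R^-1 / 2 ^+ n)).
  - by move=> n; exact: bailey_term_ge0.
  - by move=> n; rewrite mulr_ge0 ?invr_ge0.
  - exact: is_cvg_series_bailey.
  - exact: series_ln2.
rewrite [series _](_ : _ = series conv); first exact: cauchy.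
congr series; apply/funext => n; rewrite harmonic_rising_dlog binomial_legendre_coef.
have -> : 432 ^+ n * legendre_coef (1 / 6) n / 864 ^+ n = legendre_coef (1 / 6) n / 2 ^+ n :> R.
  have -> : 864 = 432 * 2 :> R by ring.
  have y0 : 432 ^+ n != 0 :> R by apply: expf_neq0; rewrite pnatr_eq0.
  by rewrite exprMn -mulf_div (divff y0) mul1r.
(* The term k = n of the convolution is 0, being a multiple of 0^-1 = 0. *)
rewrite mulrAC legendre_coef_dlog// /conv big_ord_recr/= subnn invr0 mul0r mulr0 addr0 mulr_suml.
apply: eq_bigr => -[k kn] _ /=.
have -> : 2 ^+ n = 2 ^+ k * 2 ^+ (n - k) :> R by rewrite -exprD subnKC// ltnW.
by rewrite bailey_term1 invfM; ring.
Qed.
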